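(* Let $a<0<b$, let $0<\tau<\infty$, and let $l\colon[0,\tau]\to(a,b)$ be continuously differentiable. Let $X=L^2([a,b],\mathbb{R}^2)$ and let $\mathcal{Q}^{\pm}\in\mathcal{C}^1([a,b],\mathbb{R}^{2\times2})$ be diagonal, $\mathcal{Q}^{\pm}(z)=\mathrm{diag}(q_{11}^{\pm}(z),q_{22}^{\pm}(z))$, with $mI_2\le\mathcal{Q}^{\pm}(z)\le MI_2$ for all $z\in[a,b]$ and some constants $0<m\le M$, and suppose that $$\frac{q_{11}^+}{q_{11}^-}(0)=1\quad\text{and}\quad \frac{q_{11}^+}{q_{11}^-}(z)=\frac{q_{22}^+}{q_{22}^-}(z)\ \text{ for all } z\in[a,b].$$ Let $r=0$ and let $W_B\in\mathbb{R}^{2\times4}$ satisfy $\operatorname{rank}(W_B)=2$ and $W_B\Sigma W_B^{\top}\ge0$, where $\Sigma=\begin{bmatrix}0&I_2\\ I_2&0\end{bmatrix}$. For $t\in[0,\tau]$ let $A(t)$ be the operator on $X$ defined (see context) with interface position $l(t)$. Then there exists $\omega>0$ such that for every $t\in[0,\tau]$ and every $x\in D(A(t))$, $$\langle A(t)x,x\rangle_{\mathcal{Q}_0}\le\omega\|x\|_{\mathcal{Q}_0}^2 .$$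
   Context: $P_1=\begin{bmatrix}0&-1\\-1&0\end{bmatrix}$. For an interface position $l\in(a,b)$ define the multiplication operator $\mathcal{Q}_l$ on $X$ by $(\mathcal{Q}_l x)(z)=\mathcal{Q}^-(z)x(z)$ for $z\in[a,l)$ and $(\mathcal{Q}_l x)(z)=\mathcal{Q}^+(z)x(z)$ for $z\in(l,b]$. In particular $\mathcal{Q}_0$ is this operator with $l=0$, and $X$ carries the inner product $\langle x,y\rangle_{\mathcal{Q}_0}=\frac12\int_a^b y(z)^{\top}(\mathcal{Q}_0x)(z)\,dz$ with norm $\|\cdot\|_{\mathcal{Q}_0}$. For $y=(y_1,y_2)\in X$ write $y\in D(\mathcal{J}_l)$ if $y_2\in H^1([a,b],\mathbb{R})$ and $y_1|_{(a,l)}\in H^1((a,l),\mathbb{R})$, $y_1|_{(l,b)}\in H^1((l,b),\mathbb{R})$; for such $y$, $\mathcal{J}_l y=(-y_2',\,-y_1')$ where $y_1'$ is the derivative taken separately on $(a,l)$ and $(l,b)$ (i.e. $\mathcal{J}_l$ acts as $P_1\frac{d}{dz}$ on each subinterval). For $x\in X$ with $\mathcal{Q}_lx\in D(\mathcal{J}_l)$, set the boundary flow and effort $f_\partial=\frac1{\sqrt2}P_1[(\mathcal{Q}_lx)(b)-(\mathcal{Q}_lx)(a)]\in\mathbb{R}^2$, $e_\partial=\frac1{\sqrt2}[(\mathcal{Q}_lx)(b)+(\mathcal{Q}_lx)(a)]\in\mathbb{R}^2$, the interface flow $f_I=(\mathcal{Q}_lx)_2(l)$ and the interface effort $e_I=-[(\mathcal{Q}_lx)_1(l^+)-(\mathcal{Q}_lx)_1(l^-)]$,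 where $l^\pm$ denote one-sided limits. The operator $A_{\mathcal{Q}_l}$ has domain $D(A_{\mathcal{Q}_l})=\{x\in X:\ \mathcal{Q}_lx\in D(\mathcal{J}_l),\ f_I=re_I,\ W_B\begin{bmatrix}f_\partial\\ e_\partial\end{bmatrix}=0\}$ and acts by $A_{\mathcal{Q}_l}x=\mathcal{J}_l(\mathcal{Q}_lx)$. Finally $A(t):=A_{\mathcal{Q}_{l(t)}}$. *)

(* Defs.v *)
From HB Require Import structures.
From mathcomp Require Import all_boot all_order all_algebra.
From mathcomp Require Import all_classical all_reals all_analysis.
Set Implicit Arguments. Unset Strict Implicit. Unset Printing Implicit Defensive.
Import Order.TTheory GRing.Theory Num.Theory.
Import numFieldNormedType.Exports.
Local Open Scope classical_set_scope.
Local Open Scope ring_scope.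

Section Defs.
Variable R : realType.

Definition leb := (@lebesgue_measure R).

Definition Icc (c d : R) : set R := `[c, d]%classic.

Definition integ (c d : R) (f : R -> R) : R := Rintegral leb (Icc c d) f.

Definition sq_int (c d : R) (f : R -> R) : Prop :=
  measurable_fun (Icc c d) f /\ leb.-integrable (Icc c d) (fun z => (f z ^+ 2)%:E).

Definition C1_on (c d : R) (f : R -> R) : Prop :=
  exists df : R -> R,
    {within Icc c d, continuous f} /\ {within Icc c d, continuous df} /\
    (forall z, c < z < d -> is_derive z 1 f (df z)).

(* f in H^1([c,d]) with weak derivative g; f denotes its continuous representative *)
Definition H1_closed (c d : R) (f g : R -> R) : Prop :=
  sq_int c d g /\ forall z, c <= z <= d -> f z = f c + integ c z g.

(* f|_(c,d) in H^1((c,d)) with weak derivative g; f is the continuous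
   representative on [c,d) (value at c = trace at c) *)
Definition H1_left (c d : R) (f g : R -> R) : Prop :=
  sq_int c d g /\ forall z, c <= z < d -> f z = f c + integ c z g.

(* f|_(c,d) in H^1((c,d)) with weak derivative g; f is the continuous
   representative on (c,d] (value at d = trace at d) *)
Definition H1_right (c d : R) (f g : R -> R) : Prop :=
  sq_int c d g /\ forall z, c < z <= d -> f z = f d - integ z d g.

(* selection of Q^- (left of l) or Q^+ (right of l); the value at z = l is irrelevant *)
Definition qsel (l : R) (qm qp : R -> R) (z : R) : R := if z < l then qm z else qp z.

Definition vec2 (u v : R) : 'cV[R]_2 := \col_(i < 2) (if (i : nat) == 0%N then u else v).

Definition P1 : 'M[R]_2 := \matrix_(i < 2, j < 2) (if i == j then 0 else -1).

Definition Sigma : 'M[R]_(2 + 2) := block_mx 0 1%:M 1%:M 0.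

Definition psd2 (S : 'M[R]_2) : Prop := forall v : 'cV[R]_2, 0 <= (v^T *m S *m v) 0 0.

Definition ipQ0 (a b : R) (q11m q22m q11p q22p : R -> R) (u1 u2 v1 v2 : R -> R) : R :=
  2^-1 * integ a b (fun z => v1 z * qsel 0 q11m q11p z * u1 z
                             + v2 z * qsel 0 q22m q22p z * u2 z).

Definition domA (a b : R) (q11m q22m q11p q22p : R -> R) (r : R) (WB : 'M[R]_(2, 4))
    (l : R) (x1 x2 g1 g2 : R -> R) : Prop :=
  let y1 := fun z => qsel l q11m q11p z * x1 z in
  let y2 := fun z => qsel l q22m q22p z * x2 z in
  let fB := (Num.sqrt 2)^-1 *: (P1 *m (vec2 (y1 b) (y2 b) - vec2 (y1 a) (y2 a))) in
  let eB := (Num.sqrt 2)^-1 *: (vec2 (y1 b) (y2 b) + vec2 (y1 a) (y2 a)) in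
  let fI := y2 l in
  let eI := - (lim (y1 @ l^'+) - lim (y1 @ l^'-)) in
  [/\ sq_int a b x1 /\ sq_int a b x2,
      H1_closed a b y2 g2, H1_left a l y1 g1 /\ H1_right l b y1 g1,
      fI = r * eI & WB *m col_mx fB eB = 0].

End Defs.

(* Main.v *)
Require Import Defs.
From HB Require Import structures.
From mathcomp Require Import all_boot all_order all_algebra.
From mathcomp Require Import all_classical all_reals all_analysis measurable_realfun.
From mathcomp Require Import ring lra.
Import Order.TTheory GRing.Theory Num.Theory.
Import numFieldNormedType.Exports.
Local Open Scope classical_set_scope.
Local Open Scope ring_scope.

(** With [y = Q_l x], [p = (y1 y2)'] and [rho = q0 / ql] (the same ratio for both components),
    the integrand of [<A x, x>] is [- rho p / 2].  The weight [rho] is [1] outside the interval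
    between [0] and the interface [l], and [1 + h] inside it, where [h] is [C^1] and vanishes
    at [0].  Since [r = 0], the absolutely continuous function [P = y1 y2] vanishes at [l], so
    integrating by parts gives [2 <A x, x> = - (P b - P a) + \int h' P] with no interface term.
    The boundary condition forces [P b >= P a], and [h'] is bounded independently of [l] while
    [|P|] is dominated by the energy density. *)

(** * Integrals over closed intervals *)

Definition int_on {R : realType} (c d : R) (f : R -> R) : Prop :=
  (@lebesgue_measure R).-integrable (Icc c d) (EFin \o f).

Lemma IccP {R : realType} (c d z : R) : Icc c d z <-> c <= z <= d.
Proof. by rewrite /Icc /= in_itv. Qed.

Lemma measurable_Icc {R : realType} (c d : R) : measurable (Icc c d : set (measurableTypeR R)).
Proof. exact: measurable_itv. Qed.

Lemma int_on_sub {R : realType} (c d c' d' : R) (f : R -> R) :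
  c <= c' -> d' <= d -> int_on c d f -> int_on c' d' f.
Proof.
move=> cc dd; apply: integrableS; [exact: measurable_Icc..|].
by move=> z /IccP /andP[cz zd]; apply/IccP; rewrite (le_trans cc cz) (le_trans zd dd).
Qed.

Lemma integ_cat {R : realType} (c e d : R) (f : R -> R) : c <= e <= d ->
  int_on c d f -> integ c d f = integ c e f + integ e d f.
Proof.
move=> /andP[ce ed] If; have := @Rintegral_itvB R f (BLeft c) (BRight d) e If.
rewrite !bnd_simp => /(_ ce ed) E.
(* The difference of the first two integrals is an integral over the interval open at [e]; adding
   the null point [e] makes it closed. *)
rewrite [integ e d f]/integ /Icc -Rintegral_itv_obnd_cbnd.
  by rewrite -E /integ /Icc addrC subrK.
apply: integrableS If => //; first exact: measurable_Icc.
by move=> z /=; rewrite /Icc /= !in_itv /= => /andP[ez ->]; rewrite (le_trans ce (ltW ez)).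
Qed.

(** Giving the point [e] to the right piece only makes the union disjoint, so the integrals of the
    absolute value add up to a finite sum. *)
Lemma int_on_cat {R : realType} (c e d : R) (f : R -> R) : c <= e <= d ->
  int_on c e f -> int_on e d f -> int_on c d f.
Proof.
move=> /andP[ce ed] I1 I2.
have E : Icc c d = `[c, e[%classic `|` Icc e d.
  apply/seteqP; split => z.
    move=> /IccP /andP[cz zd]; have [ez|ze] := leP e z.
      by right; apply/IccP; rewrite ez zd.
    by left; rewrite /= in_itv /= cz ze.
  case=> [/= /[!in_itv] /= /andP[cz ze]|/IccP /andP[ez zd]]; apply/IccP.
    by rewrite cz (ltW (lt_le_trans ze ed)).
  by rewrite zd (le_trans ce ez).
have mce : measurable (`[c, e[%classic : set (measurableTypeR R)) by exact: measurable_itv.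
have I1' : (@lebesgue_measure R).-integrable `[c, e[ (EFin \o f).
  apply: integrableS I1 => //; first exact: measurable_Icc.
  by move=> z /=; rewrite /Icc /= !in_itv /= => /andP[-> /ltW].
have mf : measurable_fun (`[c, e[%classic `|` Icc e d : set (measurableTypeR R))
    (EFin \o f : measurableTypeR R -> \bar R).
  apply/measurable_funU; [exact: mce|exact: measurable_Icc|].
  by split; [exact: (measurable_int _ I1') | exact: (measurable_int _ I2)].
apply/integrableP; rewrite E; split=> //.
rewrite ge0_integral_setU //; first last.
- apply/disj_setPS => y [/=]; rewrite in_itv/= => /andP[_ ye] /IccP /andP[].
  by rewrite leNgt ye.
- exact/measurableT_comp.
- exact: measurable_Icc.
by apply: lte_add_pinfty; [case/integrableP: I1'|case/integrableP: I2].
Qed.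

(** The endpoints form a null set. This is how the values of [qsel] at its switching point, and of a
    function at an interface, are made irrelevant. *)
Lemma int_on_eq_oo {R : realType} (c d : R) (f g : R -> R) :
  (forall z, c < z < d -> f z = g z) -> int_on c d f ->
  int_on c d g /\ integ c d f = integ c d g.
Proof.
move=> fg If.
have fgo : {in `]c, d[%classic, f =1 g}.
  by move=> z; rewrite inE /= in_itv /=; exact: fg.
have Ifo : (@lebesgue_measure R).-integrable `]c, d[ (EFin \o f).
  apply: integrableS If => //; first exact: measurable_Icc.
  exact: subset_itv_oo_cc.
have Igo : (@lebesgue_measure R).-integrable `]c, d[ (EFin \o g).
  by apply: eq_integrable Ifo => // z /fgo /= ->.
have mg : measurable_fun `]c, d[ g by apply/measurable_EFinP; exact: measurable_int Igo.
have Ig : int_on c d g.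
  case/integrableP: Igo => [mg' lg]; apply/integrableP; split.
    by apply/measurable_EFinP; exact: (measurable_fun_itv_cc mg).
  rewrite (integral_itv_bndoo true false) //.
  exact/measurableT_comp.
split=> //; rewrite /integ /Rintegral; congr fine.
apply: eq_integral_itv_bounded => //.
by apply/measurable_EFinP; exact: measurable_int Ifo.
Qed.

Lemma int_on_continuous {R : realType} (c d : R) (f : R -> R) :
  {within Icc c d, continuous f} -> int_on c d f.
Proof.
by move=> cf; apply: continuous_compact_integrable => //; exact: segment_compact.
Qed.

Lemma continuous_bounded {R : realType} (c d : R) (f : R -> R) :
  {within Icc c d, continuous f} -> exists2 K, 0 < K & forall z, c <= z <= d -> `|f z| <= K.
Proof.
move=> cf.
have [N [_ HN]] := compact_bounded (continuous_compact cf (@segment_compact _ c d)).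
exists (`|N| + 1); first by rewrite ltr_wpDl.
move=> z /IccP cz; apply: (HN (`|N| + 1)); last by exists z.
by rewrite (le_lt_trans (ler_norm N))// ltrDl.
Qed.

(** The factor [F] is measurable and, by compactness, bounded on the interval. *)
Lemma int_onM {R : realType} (c d : R) (F g : R -> R) :
  {within Icc c d, continuous F} -> int_on c d g -> int_on c d (fun z => F z * g z).
Proof.
move=> cF Ig; apply: (integrableMr (measurable_Icc c d) _ _ Ig).
  by apply: subspace_continuous_measurable_fun => //; exact: measurable_Icc.
have [K _ HK] := continuous_bounded c d F cF.
exists K; split; first by rewrite num_real.
by move=> L KL z /IccP /HK /le_trans; apply; exact: ltW.
Qed.

Lemma int_onD {R : realType} (c d : R) (f g : R -> R) :
  int_on c d f -> int_on c d g -> int_on c d (fun z => f z + g z).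
Proof. move=> If Ig; exact: (integrableD (measurable_Icc c d) If Ig). Qed.

Lemma int_onZ {R : realType} (c d k : R) (f : R -> R) :
  int_on c d f -> int_on c d (fun z => k * f z).
Proof. move=> If; exact: (integrableZl (measurable_Icc c d) k If). Qed.

Lemma integD {R : realType} (c d : R) (f g : R -> R) :
  int_on c d f -> int_on c d g ->
  integ c d (fun z => f z + g z) = integ c d f + integ c d g.
Proof. move=> If Ig; exact: (RintegralD (measurable_Icc c d) If Ig). Qed.

Lemma integZ {R : realType} (c d k : R) (f : R -> R) :
  int_on c d f -> integ c d (fun z => k * f z) = k * integ c d f.
Proof. move=> If; exact: (RintegralZl k (measurable_Icc c d) If). Qed.

Lemma eq_integ {R : realType} (c d : R) (f g : R -> R) :
  (forall z, c <= z <= d -> f z = g z) -> integ c d f = integ c d g.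
Proof. by move=> fg; apply: eq_Rintegral => z; rewrite inE => /IccP /fg. Qed.

Lemma eq_int_on {R : realType} (c d : R) (f g : R -> R) :
  (forall z, c <= z <= d -> f z = g z) -> int_on c d f -> int_on c d g.
Proof.
move=> fg; apply: eq_integrable; first exact: measurable_Icc.
by move=> z; rewrite inE => /IccP /fg /= ->.
Qed.

Lemma int_onN {R : realType} (c d : R) (f : R -> R) :
  int_on c d f -> int_on c d (fun z => - f z).
Proof.
by move=> If; apply: eq_int_on (int_onZ c d (-1) f If) => z _; rewrite mulN1r.
Qed.

Lemma integN {R : realType} (c d : R) (f : R -> R) :
  int_on c d f -> integ c d (fun z => - f z) = - integ c d f.
Proof.
by move=> If; rewrite -mulN1r -integZ//; apply: eq_integ => z _; rewrite mulN1r.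
Qed.

Lemma le_integ {R : realType} (c d : R) (f g : R -> R) :
  int_on c d f -> int_on c d g -> (forall z, c <= z <= d -> f z <= g z) ->
  integ c d f <= integ c d g.
Proof.
by move=> If Ig fg; apply: (le_Rintegral (measurable_Icc c d)) => // z /IccP; exact: fg.
Qed.

Lemma integ_ge0 {R : realType} (c d : R) (f : R -> R) :
  (forall z, c <= z <= d -> 0 <= f z) -> 0 <= integ c d f.
Proof. by move=> f0; apply: Rintegral_ge0 => z /IccP; exact: f0. Qed.

Lemma integ_point {R : realType} (c : R) (f : R -> R) : integ c c f = 0.
Proof. by rewrite /integ /Icc set_itv1 Rintegral_set1. Qed.

(** Domination by [1 + f ^ 2], whose constant term is integrable because the interval is bounded. *)
Lemma sq_int_int_on {R : realType} (c d : R) (f : R -> R) : sq_int c d f -> int_on c d f.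
Proof.
move=> [mf If].
have I1 : int_on c d (fun=> 1).
  by apply: int_on_continuous => z; exact: cvg_cst.
apply: (le_integrable (measurable_Icc c d) _ _ (int_onD _ _ _ _ I1 If)).
  exact/measurable_EFinP.
move=> z _ /=; rewrite lee_fin [leRHS]ger0_norm ?addr_ge0 ?sqr_ge0//.
rewrite -real_normK ?num_real//; have := normr_ge0 (f z); nra.
Qed.

(** * Extension by zero and Fubini's theorem *)

Lemma integ_patch {R : realType} (c d : R) (f : R -> R) :
  integ c d f = fine (\int[@lebesgue_measure R]_x ((f \_ (Icc c d)) x)%:E)%E.
Proof. by rewrite /integ Rintegral_mkcond. Qed.

Lemma int_on_patch {R : realType} (c d : R) (f : R -> R) : int_on c d f ->
  (@lebesgue_measure R).-integrable [set: measurableTypeR R] (EFin \o (f \_ (Icc c d))) /\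
  (\int[@lebesgue_measure R]_x ((f \_ (Icc c d)) x)%:E)%E = (integ c d f)%:E.
Proof.
move=> If; have I' : (@lebesgue_measure R).-integrable [set: measurableTypeR R]
    (EFin \o (f \_ (Icc c d))).
  rewrite -restrict_EFin.
  exact: (integrable_mkcond (mu := @lebesgue_measure R) (EFin \o f) (measurable_Icc c d)).1.
split=> //; rewrite /integ Rintegral_mkcond /Rintegral fineK //.
exact: (integrable_fin_num measurableT I').
Qed.

(** By Tonelli, the iterated integral of the absolute value factors into the product of two finite
    integrals. *)
Lemma integrable_prod_patch {R : realType} (c d : R) (f g : R -> R) :
  int_on c d f -> int_on c d g ->
  (@lebesgue_measure R \x @lebesgue_measure R)%E.-integrable
    [set: measurableTypeR R * measurableTypeR R]
    (fun p => ((g \_ (Icc c d)) p.1 * (f \_ (Icc c d)) p.2)%:E).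
Proof.
move=> /int_on_patch[If _] /int_on_patch[Ig _].
set mu := @lebesgue_measure R.
have mf : measurable_fun [set: measurableTypeR R] (f \_ (Icc c d)).
  by apply/measurable_EFinP; exact: measurable_int If.
have mg : measurable_fun [set: measurableTypeR R] (g \_ (Icc c d)).
  by apply/measurable_EFinP; exact: measurable_int Ig.
apply/integrable12ltyP.
  apply/measurable_EFinP; apply: measurable_funM.
    by apply: measurableT_comp => //; exact: measurable_fst.
  by apply: measurableT_comp => //; exact: measurable_snd.
have If' := integrable_abse If; have Ig' := integrable_abse Ig.
have Ff : (\int[mu]_y (`|(f \_ (Icc c d)) y|)%:E)%E \is a fin_num.
  exact: (integrable_fin_num measurableT If').
have Fg : (\int[mu]_y (`|(g \_ (Icc c d)) y|)%:E)%E \is a fin_num.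
  exact: (integrable_fin_num measurableT Ig').
under eq_integral => x _.
  under eq_integral => y _ do rewrite /= normrM EFinM.
  rewrite (integralZl measurableT If') -(fineK Ff) muleC.
  over.
by rewrite (integralZl measurableT Ig') -(fineK Fg) -EFinM ltry.
Qed.

(* Fubini on the triangle [c <= t <= s <= d]. *)
Lemma integ_triangle {R : realType} (c d : R) (f g : R -> R) :
  int_on c d f -> int_on c d g ->
  integ c d (fun s => g s * integ c s f) = integ c d (fun t => f t * integ t d g).
Proof.
move=> If Ig; pose mu := @lebesgue_measure R.
(* The triangle enters as the indicator of [p.2 <= p.1], with [p.1] in the role of [s] and [p.2] in
   that of [t]. Integrating out either variable then gives one of the two integrands, extended by
   zero. *)
pose H (p : measurableTypeR R * measurableTypeR R) : \bar R :=
  (((g \_ (Icc c d)) p.1 * (f \_ (Icc c d)) p.2) * (p.2 <= p.1)%R%:R)%:E.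
have IH : (mu \x mu)%E.-integrable [set: measurableTypeR R * measurableTypeR R] H.
  have IK := integrable_prod_patch c d f g If Ig.
  apply: (le_integrable measurableT _ _ IK).
    apply/measurable_EFinP; apply: measurable_funM.
      by apply/measurable_EFinP; exact: measurable_int IK.
    apply: measurableT_comp => //; apply: measurable_fun_ler.
      exact: measurable_snd.
    exact: measurable_fst.
  move=> p _; rewrite /H lee_fin; case: (p.2 <= p.1).
    by rewrite mulr1.
  by rewrite mulr0 normr0.
have E1 s : (\int[mu]_t H (s, t))%E = (((fun s => g s * integ c s f) \_ (Icc c d)) s)%:E.
  rewrite /H /= [in RHS]patchE; case: ifPn => [|sN].
    rewrite inE => /IccP /andP[cs sd].
    have [I1 E] := int_on_patch c s f (int_on_sub _ _ _ _ _ (lexx c) sd If).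
    rewrite [RHS]/= EFinM -E.
    rewrite -integralZl//; apply: eq_integral => t _.
    have -> : (g \_ (Icc c d)) s = g s.
      by rewrite patchE mem_set //; apply/IccP; rewrite cs sd.
    rewrite -EFinM -mulrA; congr (_ * _)%:E; rewrite !patchE.
    have -> : (t \in Icc c s) = (t \in Icc c d) && (t <= s).
      apply/idP/idP; rewrite inE.
        move=> /IccP /andP[ct ts]; rewrite ts andbT inE; apply/IccP.
        by rewrite ct (le_trans ts sd).
      by move=> /andP[/[!inE] /IccP /andP[ct td] ts]; apply/IccP; rewrite ct ts.
    by case: (t \in Icc c d); case: (t <= s); rewrite ?mulr1 ?mulr0.
  by under eq_integral do rewrite patchE (negbTE sN) !mul0r; rewrite integral0.
have E2 t : (\int[mu]_s H (s, t))%E = (((fun t => f t * integ t d g) \_ (Icc c d)) t)%:E.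
  rewrite /H /= [in RHS]patchE; case: ifPn => [|tN].
    rewrite inE => /IccP /andP[ct td].
    have [I1 E] := int_on_patch t d g (int_on_sub _ _ _ _ _ ct (lexx d) Ig).
    rewrite [RHS]/= EFinM -E.
    rewrite -integralZl//; apply: eq_integral => s _.
    have -> : (f \_ (Icc c d)) t = f t.
      by rewrite patchE mem_set //; apply/IccP; rewrite ct td.
    rewrite -EFinM mulrAC mulrC; congr (_ * _)%:E; rewrite !patchE.
    have -> : (s \in Icc t d) = (s \in Icc c d) && (t <= s).
      apply/idP/idP; rewrite inE.
        move=> /IccP /andP[ts sd]; rewrite ts andbT inE; apply/IccP.
        by rewrite sd (le_trans ct ts).
      by move=> /andP[/[!inE] /IccP /andP[cs sd] ts]; apply/IccP; rewrite sd ts.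
    by case: (s \in Icc c d); case: (t <= s); rewrite ?mulr1 ?mulr0.
  under eq_integral do rewrite [in (f \_ _) t]patchE (negbTE tN) mulr0 mul0r.
  by rewrite integral0.
have E : (\int[mu]_s \int[mu]_t H (s, t) = \int[mu]_t \int[mu]_s H (s, t))%E.
  exact: Fubini IH.
rewrite 2!integ_patch -/mu; congr (fine _).
under eq_integral do rewrite -E1.
by rewrite E; under eq_integral do rewrite E2.
Qed.

(** * Absolutely continuous functions *)

(** Absolute continuity as an integral representation. The density [f] is explicit, and no pointwise
    derivative of [F] is asserted. *)
Definition ac_on {R : realType} (c d : R) (F f : R -> R) : Prop :=
  int_on c d f /\ forall z, c <= z <= d -> F z = F c + integ c z f.

Lemma ac_onB {R : realType} (c d : R) (F f : R -> R) (u v : R) : ac_on c d F f ->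
  c <= u -> u <= v -> v <= d -> F v - F u = integ u v f.
Proof.
move=> [If FE] cu uv vd; have cv := le_trans cu uv.
rewrite (FE v) ?cv// (FE u) ?cu ?(le_trans uv vd)//.
rewrite (@integ_cat _ c u v) ?cu ?uv//; first by ring.
exact: int_on_sub (lexx c) vd If.
Qed.

Lemma ac_on_continuous {R : realType} (c d : R) (F f : R -> R) : ac_on c d F f ->
  {within Icc c d, continuous F}.
Proof.
move=> [If FE]; have [cd|dc] := leP c d; last first.
  by rewrite /Icc set_itv_ge ?bnd_simp -?ltNge//; exact: continuous_subspace0.
have cI := parameterized_integral_continuous cd If.
apply: (@subspace_eq_continuous _ _ _ (fun z => F c + integ c z f)).
  by move=> z; rewrite inE => /IccP /FE /esym.
move=> z; apply: cvgD; first exact: cvg_cst.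
exact: cI.
Qed.

Lemma ac_on_sub {R : realType} (c d c' d' : R) (F f : R -> R) : c <= c' -> d' <= d ->
  ac_on c d F f -> ac_on c' d' F f.
Proof.
move=> cc dd aF; split; first exact: int_on_sub cc dd aF.1.
move=> z /andP[cz zd]; rewrite -(@ac_onB _ c d F f c' z) ?(le_trans zd dd)//; ring.
Qed.

Lemma ac_on_cat {R : realType} (c e d : R) (F f : R -> R) : c <= e <= d ->
  ac_on c e F f -> ac_on e d F f -> ac_on c d F f.
Proof.
move=> /andP[ce ed] aF aG.
have If : int_on c d f by apply: (@int_on_cat _ c e) aF.1 aG.1; rewrite ce ed.
split=> // z /andP[cz zd]; have [ze|ez] := leP z e; first by apply: aF.2; rewrite cz ze.
rewrite (@integ_cat _ c e z) ?ce ?(ltW ez)//; last exact: int_on_sub (lexx c) zd If.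
by rewrite addrA -aF.2 ?ce ?lexx//; apply: aG.2; rewrite (ltW ez).
Qed.

(** The functions have to agree up to the endpoints, since their values there are traces; the
    densities only matter almost everywhere. *)
Lemma eq_ac_on {R : realType} (c d : R) (F G f g : R -> R) :
  (forall z, c <= z <= d -> F z = G z) -> (forall z, c < z < d -> f z = g z) ->
  ac_on c d F f -> ac_on c d G g.
Proof.
move=> FG fg [If FE]; split; first exact: (int_on_eq_oo c d f g fg If).1.
move=> z /andP[cz zd]; have cd := le_trans cz zd.
rewrite -!FG ?lexx ?cz ?zd ?cd// FE ?cz ?zd//; congr (_ + _).
apply: (int_on_eq_oo c z f g _ (int_on_sub _ _ _ _ _ (lexx c) zd If)).2.
by move=> t /andP[ct tz]; apply: fg; rewrite ct (lt_le_trans tz zd).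
Qed.

(** Write [F z] as [F c] plus the integral of [f] from [c], and [G z] as [G d] minus the integral of
    [g] up to [d]. The two double integrals cancel by [integ_triangle], and the constants give the
    boundary terms. *)
Lemma integ_ibp {R : realType} (c d : R) (F G f g : R -> R) : c <= d ->
  ac_on c d F f -> ac_on c d G g ->
  integ c d (fun z => F z * g z + G z * f z) = F d * G d - F c * G c.
Proof.
move=> cd aF aG; have [If FE] := aF; have [Ig GE] := aG.
have IFg := int_onM c d F g (ac_on_continuous c d F f aF) Ig.
have IGf := int_onM c d G f (ac_on_continuous c d G g aG) If.
rewrite integD//.
have -> : integ c d (fun z => F z * g z) =
    F c * integ c d g + integ c d (fun z => g z * integ c z f).
  have E z : c <= z <= d -> F z * g z = F c * g z + g z * integ c z f.
    by move=> zcd; rewrite FE//; ring.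
  rewrite (eq_integ _ _ _ _ E) integD ?integZ//; first exact: int_onZ.
  apply: eq_int_on (int_onD _ _ _ _ IFg (int_onZ _ _ (- F c) _ Ig)) => z zcd.
  by rewrite E//; ring.
rewrite integ_triangle//.
have -> : integ c d (fun z => G z * f z) =
    G d * integ c d f - integ c d (fun t => f t * integ t d g).
  have E z : c <= z <= d -> f z * integ z d g = G d * f z + - (G z * f z).
    by move=> /andP[cz zd]; rewrite -(ac_onB c d G g z d)//; ring.
  by rewrite (eq_integ _ _ _ _ E) integD ?integZ ?integN//;
    [ring | exact: int_onZ | exact: int_onN].
by rewrite -(ac_onB c d F f c d)// -(ac_onB c d G g c d)//; ring.
Qed.

Lemma ac_onM {R : realType} (c d : R) (F G f g : R -> R) :
  ac_on c d F f -> ac_on c d G g ->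
  ac_on c d (fun z => F z * G z) (fun z => F z * g z + G z * f z).
Proof.
move=> aF aG; split.
  apply: int_onD; apply: int_onM; [|exact: aG.1| |exact: aF.1].
    exact: ac_on_continuous aF.
  exact: ac_on_continuous aG.
move=> z /andP[cz zd].
by rewrite (integ_ibp c z F G f g cz (ac_on_sub _ _ _ _ _ _ (lexx c) zd aF)
  (ac_on_sub _ _ _ _ _ _ (lexx c) zd aG)); ring.
Qed.

(** * Dissipativity of the boundary conditions *)

(** For [n = 2] this is [Sigma]. Its quadratic form at [col_mx f e] is twice the pairing of [f] and
    [e]. *)
Definition swap_mx (R : realFieldType) (n : nat) : 'M[R]_(n + n) :=
  block_mx 0 1%:M 1%:M 0.

Lemma swap_mxK (R : realFieldType) (n : nat) : swap_mx R n *m swap_mx R n = 1%:M.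
Proof.
by rewrite mulmx_block !mulmx0 !mul0mx !mulmx1 !add0r addr0 -scalar_mx_block.
Qed.

Lemma tr_swap_mx (R : realFieldType) (n : nat) : (swap_mx R n)^T = swap_mx R n.
Proof. by rewrite tr_block_mx !trmx0 !trmx1. Qed.

Lemma row_sqr_ge0 (R : realFieldType) (n : nat) (x : 'rV[R]_n) : 0 <= (x *m x^T) 0 0.
Proof. by rewrite mxE; apply: sumr_ge0 => i _; rewrite mxE -expr2 sqr_ge0. Qed.

Lemma row_sqr_eq0 (R : realFieldType) (n : nat) (x : 'rV[R]_n) :
  (x *m x^T) 0 0 <= 0 -> x = 0.
Proof.
move=> x0; have /eqP : (x *m x^T) 0 0 = 0 by apply/eqP; rewrite eq_le x0 row_sqr_ge0.
rewrite mxE psumr_eq0; last by move=> i _; rewrite mxE -expr2 sqr_ge0.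
move=> /allP x00; apply/rowP => i; have := x00 i (mem_index_enum i).
by rewrite !mxE /= -expr2 sqrf_eq0 => /eqP.
Qed.

(* If the form were positive at [v], it would be nonnegative on the span of the rows of
   [W *m swap_mx] and [v^T], whose dimension forces it to meet the negative definite subspace
   of the vectors [row_mx x (- x)]. *)
Lemma ker_swap_form_le0 (R : realFieldType) (n : nat) (W : 'M[R]_(n, n + n))
  (v : 'cV[R]_(n + n)) : \rank W = n ->
  (forall u : 'rV[R]_n, 0 <= (u *m (W *m swap_mx R n *m W^T) *m u^T) 0 0) ->
  W *m v = 0 -> (v^T *m swap_mx R n *m v) 0 0 <= 0.
Proof.
move=> rW psd Wv; rewrite leNgt; apply/negP => q0.
set S := swap_mx R n in psd q0 *.
pose K : 'M[R]_(n + 1, n + n) := col_mx (W *m S) v^T.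
pose N : 'M[R]_(n + 1, n) := K *m col_mx 1%:M 1%:M.
(* [N] adds the two halves of each row of [K]. It has [n + 1] rows and [n] columns, so some nonzero
   combination [p] of the rows of [K] has opposite halves. *)
have /rowV0Pn [p /sub_kermxP pN p0] : kermx N != 0.
  rewrite kermx_eq0 /row_free neq_ltn.
  by rewrite (leq_ltn_trans (rank_leq_col N))// addn1.
pose u := lsubmx p; pose c := rsubmx p.
pose w := u *m (W *m S) + c *m v^T.
have pE : p = row_mx u c by rewrite hsubmxK.
have wE : p *m K = w by rewrite pE mul_row_col.
pose x := lsubmx w.
have wx : w = row_mx x (- x).
  move: pN; rewrite mulmxA wE -[w in w *m _]hsubmxK mul_row_col !mulmx1 => /eqP.
  by rewrite addr_eq0 => /eqP xE; rewrite -[LHS]hsubmxK /x xE opprK.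
have form_neg : (w *m S *m w^T) 0 0 = - 2 * (x *m x^T) 0 0.
  rewrite wx mul_row_block !mulmx0 !mulmx1 add0r addr0 tr_row_mx mul_row_col.
  by rewrite linearN /= mulNmx mulmxN !mxE; ring.
have SS : S *m S = 1%:M := swap_mxK R n.
have SSK q (A : 'M[R]_(n + n, q)) : S *m (S *m A) = A by rewrite mulmxA SS mul1mx.
have vW : v^T *m W^T = 0 by rewrite -trmx_mul Wv trmx0.
(* The cross terms reduce to [W *m v] and its transpose because [S] is an involution, and these
   vanish. *)
have form_pos : (w *m S *m w^T) 0 0 =
    (u *m (W *m S *m W^T) *m u^T) 0 0 + (c 0 0) ^+ 2 * (v^T *m S *m v) 0 0.
  have -> : w *m S *m w^T = u *m (W *m S *m W^T) *m u^T + c *m (v^T *m S *m v) *m c^T.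
    rewrite /w linearD /= !trmx_mul trmxK tr_swap_mx -/S.
    rewrite !mulmxDl !mulmxDr -!mulmxA !SSK.
    rewrite (mulmxA W v) Wv mul0mx mulmx0 addr0.
    rewrite (mulmxA v^T W^T) vW mul0mx mulmx0 add0r.
    by rewrite !mulmxA.
  rewrite mxE; congr (_ + _).
  rewrite [c]mx11_scalar mul_scalar_mx tr_scalar_mx mul_mx_scalar !mxE eqxx mulr1n.
  by ring.
(* Equating the two expressions of the form leaves a sum of nonnegative terms equal to zero. Hence
   [c] and [x] vanish, then [u *m W = 0], and the full rank of [W] contradicts [p != 0]. *)
have c0 : c = 0.
  have : (c 0 0) ^+ 2 * (v^T *m S *m v) 0 0 <= 0.
    have := psd u; have := row_sqr_ge0 R n x; lra.
  rewrite pmulr_lle0// => c2; have : (c 0 0) ^+ 2 = 0.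
    by apply/eqP; rewrite eq_le c2 sqr_ge0.
  move=> /eqP; rewrite sqrf_eq0 => /eqP c00.
  by rewrite [c]mx11_scalar c00 raddf0.
have x0 : x = 0.
  apply: row_sqr_eq0; have := psd u; have : 0 <= (c 0 0) ^+ 2 * (v^T *m S *m v) 0 0.
    by rewrite mulr_ge0 ?sqr_ge0// ltW.
  lra.
have : u *m W = 0.
  have : w = 0 by rewrite wx x0 oppr0 row_mx0.
  rewrite /w c0 mul0mx addr0 => /(congr1 (mulmx^~ S)).
  by rewrite mul0mx -!mulmxA SS mulmx1.
move=> /eqP; rewrite mulmx_free_eq0; last by rewrite /row_free rW.
by move=> /eqP u0; move: p0; rewrite pE u0 c0 row_mx0 eqxx.
Qed.

(* With [f = P1 (yb - ya) / sqrt 2] and [e = (yb + ya) / sqrt 2], the swap form of the pair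
   [(f, e)] is [2 f^T e = yb^T P1 yb - ya^T P1 ya]. *)
Lemma boundary_flux_ge0 (R : realType) (WB : 'M[R]_(2, 4)) (ya1 ya2 yb1 yb2 : R) :
  \rank WB = 2%N -> psd2 (WB *m Sigma R *m WB^T) ->
  WB *m col_mx ((Num.sqrt 2)^-1 *: (P1 R *m (vec2 yb1 yb2 - vec2 ya1 ya2)))
    ((Num.sqrt 2)^-1 *: (vec2 yb1 yb2 + vec2 ya1 ya2)) = 0 ->
  ya1 * ya2 <= yb1 * yb2.
Proof.
move=> rW psd; set f := _ *: _; set e := _ *: _ => Wfe.
have := ker_swap_form_le0 R 2 WB (col_mx f e) rW _ Wfe.
have psd' (u : 'rV[R]_2) : 0 <= (u *m (WB *m swap_mx R 2 *m WB^T) *m u^T) 0 0.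
  by have := psd u^T; rewrite trmxK.
move=> /(_ psd').
rewrite tr_col_mx mul_row_block !mulmx0 !mulmx1 add0r addr0 mul_row_col.
rewrite /f /e !mxE !big_ord_recl !big_ord0 !mxE !big_ord_recl !big_ord0 !mxE /=.
have s2 : (Num.sqrt 2)^-1 * (Num.sqrt 2)^-1 = 2^-1 :> R.
  by rewrite -invfM -expr2 sqr_sqrtr.
move: s2; set s := (Num.sqrt 2)^-1 => s2 H.
(* As [P1] is minus the swap, the form in [H] is [- 4 * (s * s) * (yb1 * yb2 - ya1 * ya2)]. *)
have : 0 <= (s * s) * (yb1 * yb2 - ya1 * ya2) by nra.
by rewrite s2 pmulr_rge0// subr_ge0.
Qed.

(** * Energy estimate *)

Lemma C1_on_div {R : realType} (c d : R) (f g : R -> R) :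
  (forall z, c <= z <= d -> g z != 0) -> C1_on c d f -> C1_on c d g ->
  C1_on c d (fun z => f z / g z).
Proof.
move=> g0 [df [cf [cdf Df]]] [dg [cg [cdg Dg]]].
exists (fun z => df z / g z - f z * dg z / (g z * g z)).
move: cf cdf cg cdg => /subspace_continuousP cf /subspace_continuousP cdf
  /subspace_continuousP cg /subspace_continuousP cdg.
split; [|split].
- apply/subspace_continuousP => z zcd; apply: cvgM; first exact: cf.
  by apply: cvgV; [apply: g0; exact/IccP | exact: cg].
- apply/subspace_continuousP => z zcd; have gz0 : g z != 0 by apply: g0; exact/IccP.
  apply: cvgB; apply: cvgM.
  + exact: cdf.
  + by apply: cvgV => //; exact: cg.
  + by apply: cvgM; [exact: cf | exact: cdg].
  + by apply: cvgV; [rewrite mulf_neq0 | apply: cvgM; exact: cg].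
- move=> z zcd; have gz0 : g z != 0.
    by move: zcd => /andP[cz zd]; apply: g0; rewrite !ltW.
  have D := is_deriveM (Df z zcd) (is_deriveV gz0 (Dg z zcd)).
  apply: (is_derive_eq D); rewrite /GRing.scale /=; field.
  exact: gz0.
Qed.

(** Fundamental theorem of calculus, with the derivative given inside the interval and its formula
    [df] continuous up to the ends. Continuity of [df] is kept for bounding it later. *)
Lemma C1_on_ac {R : realType} (c d : R) (f : R -> R) : C1_on c d f ->
  exists df, ac_on c d f df /\ {within Icc c d, continuous df}.
Proof.
move=> [df [cf [cdf Df]]]; exists df; split=> //; split; first exact: int_on_continuous.
move=> z /andP[]; rewrite le_eqVlt => /predU1P[<- _|cz zd].
  by rewrite integ_point addr0.
have sub : `[c, z]%classic `<=` Icc c d.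
  by move=> t /=; rewrite in_itv /= => /andP[ct tz]; apply/IccP; rewrite ct (le_trans tz zd).
have := continuous_FTC2 cz (continuous_subspaceW sub cdf) (F := f).
have [cfo fc fz] := (continuous_within_itvP f cz).1 (continuous_subspaceW sub cf).
have Dz t : t \in `]c, z[ -> is_derive t 1 f (df t).
  by rewrite in_itv /= => /andP[ct tz]; apply: Df; rewrite ct (lt_le_trans tz zd).
move=> FTC; have : (\int[lebesgue_measure]_(x in `[c, z]) (df x)%:E = (f z)%:E - (f c)%:E)%E.
  apply: FTC; first by split=> // t /Dz[].
  by move=> t /Dz dt; rewrite derive1E derive_val.
by rewrite /integ /Rintegral => -> /=; ring.
Qed.

(** Here [y1] may jump at [l]. On each side it is replaced by its continuous extension, which can
    differ from [y1] only at [l]; there both products vanish because [y2 l = 0], so the two halves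
    glue. *)
Lemma ac_on_flux {R : realType} (a b l : R) (y1 y2 g1 g2 : R -> R) : a < l < b ->
  H1_left a l y1 g1 -> H1_right l b y1 g1 -> H1_closed a b y2 g2 -> y2 l = 0 ->
  ac_on a b (fun z => y1 z * y2 z) (fun z => y1 z * g2 z + y2 z * g1 z).
Proof.
move=> /andP[al lb] [g1l y1l] [g1r y1r] [g2s y2E] y2l.
have a2 : ac_on a b y2 g2 by split=> //; exact: sq_int_int_on.
have I1l : int_on a l g1 by exact: sq_int_int_on.
have I1r : int_on l b g1 by exact: sq_int_int_on.
apply: (@ac_on_cat _ a l); first by rewrite !ltW.
- have aY : ac_on a l (fun z => y1 a + integ a z g1) g1.
    by split=> // z _; rewrite integ_point addr0.
  apply: eq_ac_on (ac_onM _ _ _ _ _ _ aY (ac_on_sub _ _ _ _ _ _ (lexx a) (ltW lb) a2)).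
    move=> z /andP[az]; rewrite le_eqVlt => /predU1P[->|zl]; first by rewrite y2l !mulr0.
    by rewrite -y1l// az zl.
  by move=> z /andP[az zl]; rewrite -y1l// zl ltW.
(* The value of this extension at [l] is [y1 b - integ l b g1], the right trace of [y1]. *)
- have aY : ac_on l b (fun z => y1 b - integ l b g1 + integ l z g1) g1.
    by split=> // z _; rewrite integ_point addr0.
  have YE z : l < z -> z <= b -> y1 b - integ l b g1 + integ l z g1 = y1 z.
    move=> lz zb; rewrite (@integ_cat _ l z b) ?zb ?ltW// [in RHS]y1r ?lz//.
    by ring.
  apply: eq_ac_on (ac_onM _ _ _ _ _ _ aY (ac_on_sub _ _ _ _ _ _ (ltW al) (lexx b) a2)).
    move=> z /andP[]; rewrite le_eqVlt => /predU1P[<- _|lz zb].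
      by rewrite y2l !mulr0.
    by rewrite YE.
  by move=> z /andP[lz zb]; rewrite YE// ltW.
Qed.

(** The weight is [1 + h] on the middle piece and [1] elsewhere. Integrating [h * p] by parts leaves
    no boundary term, since [h * P] vanishes at both ends. Stating this for products covers both
    orders of the origin (zero of [h]) and the interface (zero of [P]). *)
Lemma integ_flux {R : realType} (a c d b : R) (P p h h' phi : R -> R) :
  a <= c -> c <= d -> d <= b -> ac_on a b P p -> ac_on c d h h' ->
  h c * P c = 0 -> h d * P d = 0 ->
  (forall z, a < z < c -> phi z = - p z) ->
  (forall z, c < z < d -> phi z = - (p z + h z * p z)) ->
  (forall z, d < z < b -> phi z = - p z) ->
  int_on c d (fun z => h' z * P z) /\
  integ a b phi = P a - P b + integ c d (fun z => h' z * P z).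
Proof.
move=> ac cd db aP ah hc hd phi1 phi2 phi3.
have ad := le_trans ac cd; have cb := le_trans cd db.
have aP2 := ac_on_sub _ _ _ _ _ _ ac db aP.
have Ihp : int_on c d (fun z => h z * p z).
  by apply: int_onM aP2.1; exact: ac_on_continuous ah.
have IPh : int_on c d (fun z => P z * h' z).
  by apply: int_onM ah.1; exact: ac_on_continuous aP2.
have IhP : int_on c d (fun z => h' z * P z).
  by apply: eq_int_on IPh => z _; rewrite mulrC.
split=> //.
have [I1 E1] := int_on_eq_oo a c (fun z => - p z) phi (fun z H => esym (phi1 z H))
  (int_onN _ _ _ (int_on_sub _ _ _ _ _ (lexx a) cb aP.1)).
have [I2 E2] := int_on_eq_oo c d (fun z => - (p z + h z * p z)) phi
  (fun z H => esym (phi2 z H)) (int_onN _ _ _ (int_onD _ _ _ _ aP2.1 Ihp)).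
have [I3 E3] := int_on_eq_oo d b (fun z => - p z) phi (fun z H => esym (phi3 z H))
  (int_onN _ _ _ (int_on_sub _ _ _ _ _ ad (lexx b) aP.1)).
have Icb : int_on c b phi by apply: (@int_on_cat _ c d b); rewrite ?cd.
have Iab : int_on a b phi by apply: (@int_on_cat _ a c b); rewrite ?ac.
rewrite (@integ_cat _ a c b) ?ac// (@integ_cat _ c d b) ?cd//.
rewrite -E1 -E2 -E3 !integN; [|exact: int_on_sub ad (lexx b) aP.1
  |exact: int_onD aP2.1 Ihp|exact: int_on_sub (lexx a) cb aP.1].
rewrite integD//; last exact: aP2.1.
rewrite -(ac_onB a b P p a c)// -(ac_onB a b P p c d)// -(ac_onB a b P p d b)//.
have := integ_ibp c d h P h' p cd ah aP2; rewrite hc hd subrr integD//.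
rewrite (eq_integ c d (fun z => P z * h' z) (fun z => h' z * P z)); last first.
  by move=> z _; rewrite mulrC.
lra.
Qed.

(** In [integ_flux] the term [P a - P b] is nonpositive, and [h' * P] is at most [K * C * w]. Since
    [w] is nonnegative, its integral over [Icc c d] is at most that over [Icc a b]. *)
Lemma flux_estimate {R : realType} (a c d b K C : R) (P p h h' phi w : R -> R) :
  a <= c -> c <= d -> d <= b -> ac_on a b P p -> ac_on c d h h' ->
  h c * P c = 0 -> h d * P d = 0 ->
  (forall z, a < z < c -> phi z = - p z) ->
  (forall z, c < z < d -> phi z = - (p z + h z * p z)) ->
  (forall z, d < z < b -> phi z = - p z) ->
  P a <= P b -> (forall z, c <= z <= d -> `|h' z| <= K) ->
  (forall z, a <= z <= b -> `|P z| <= C * w z) ->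
  0 <= K -> 0 <= C -> int_on a b w -> (forall z, a <= z <= b -> 0 <= w z) ->
  integ a b phi <= K * C * integ a b w.
Proof.
move=> ac cd db aP ah hc hd phi1 phi2 phi3 Pab hK PC K0 C0 Iw w0.
have [IhP ->] := integ_flux a c d b P p h h' phi ac cd db aP ah hc hd phi1 phi2 phi3.
have ad := le_trans ac cd; have cb := le_trans cd db.
have Icd : int_on c d w := int_on_sub _ _ _ _ _ ac db Iw.
have le1 : integ c d (fun z => h' z * P z) <= K * C * integ c d w.
  rewrite -integZ//; apply: le_integ => //; first exact: int_onZ.
  move=> z /andP[cz zd]; rewrite (le_trans (ler_norm _))// normrM -mulrA.
  apply: ler_pM => //; first by apply: hK; rewrite cz.
  by apply: PC; rewrite (le_trans ac cz) (le_trans zd db).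
have le2 : integ c d w <= integ a b w.
  rewrite (@integ_cat _ a c b) ?ac// (@integ_cat _ c d b) ?cd//; last first.
    exact: int_on_sub ac (lexx b) Iw.
  have : 0 <= integ a c w.
    by apply: integ_ge0 => z /andP[az zc]; apply: w0; rewrite az (le_trans zc cb).
  have : 0 <= integ d b w.
    by apply: integ_ge0 => z /andP[dz zb]; apply: w0; rewrite zb (le_trans ad dz).
  lra.
have := ler_wpM2l (mulr_ge0 K0 C0) le2; lra.
Qed.

(** On each side of [0] the selected coefficients are continuous and multiply integrable squares;
    the pieces are glued at [0]. *)
Lemma int_on_energy {R : realType} (a b : R) (q1m q2m q1p q2p x1 x2 : R -> R) :
  a <= 0 <= b -> C1_on a b q1m -> C1_on a b q2m -> C1_on a b q1p -> C1_on a b q2p ->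
  sq_int a b x1 -> sq_int a b x2 ->
  int_on a b (fun z => x1 z * qsel 0 q1m q1p z * x1 z + x2 z * qsel 0 q2m q2p z * x2 z).
Proof.
move=> /andP[a0 b0] [_ [c1m _]] [_ [c2m _]] [_ [c1p _]] [_ [c2p _]] [_ s1] [_ s2].
have S1 : int_on a b (fun z => x1 z ^+ 2) := s1.
have S2 : int_on a b (fun z => x2 z ^+ 2) := s2.
have I (q1 q2 : R -> R) : {within Icc a b, continuous q1} -> {within Icc a b, continuous q2} ->
    int_on a b (fun z => x1 z * q1 z * x1 z + x2 z * q2 z * x2 z).
  move=> cq1 cq2; apply: eq_int_on (int_onD _ _ _ _ (int_onM _ _ _ _ cq1 S1)
    (int_onM _ _ _ _ cq2 S2)) => z _.
  by ring.
apply: (@int_on_cat _ a 0 b); first by rewrite a0 b0.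
  apply: (int_on_eq_oo a 0 (fun z => x1 z * q1m z * x1 z + x2 z * q2m z * x2 z) _ _ _).1.
    by move=> z /andP[_ z0]; rewrite /qsel z0.
  exact: int_on_sub (lexx a) b0 (I _ _ c1m c2m).
apply: (int_on_eq_oo 0 b (fun z => x1 z * q1p z * x1 z + x2 z * q2p z * x2 z) _ _ _).1.
  by move=> z /andP[z0 _]; rewrite /qsel ltNge (ltW z0).
exact: int_on_sub a0 (lexx b) (I _ _ c1p c2p).
Qed.

Lemma ac_onB1 {R : realType} (a b c d : R) (F f : R -> R) : a <= c -> d <= b ->
  ac_on a b F f -> ac_on c d (fun z => F z - 1) f.
Proof.
move=> ac db aF; have [If FE] := ac_on_sub _ _ _ _ _ _ ac db aF.
by split=> // z /FE ->; ring.
Qed.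

(* Weighted AM-GM: [u] and [v] stand for [Q_l]-entries and [s] and [t] for [Q_0]-entries. *)
Lemma flux_le_energy {R : realFieldType} (m M u v s t x y : R) : 0 < m ->
  m <= u <= M -> m <= v <= M -> m <= s -> m <= t ->
  `|u * x * (v * y)| <= M ^+ 2 / (2 * m) * (x * s * x + y * t * y).
Proof.
move=> m0 /andP[mu uM] /andP[mv vM] ms mt.
have u0 : 0 <= u by lra.
have v0 : 0 <= v by lra.
have uv : u * v <= M ^+ 2 by rewrite expr2 ler_pM.
rewrite (_ : u * x * (v * y) = (u * v) * (x * y)); last by ring.
rewrite normrM ger0_norm ?mulr_ge0//.
have xy : `|x * y| <= (x ^+ 2 + y ^+ 2) / 2.
  have := sqr_ge0 (x + y); have := sqr_ge0 (x - y).
  by rewrite ler_norml sqrrB sqrrD; lra.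
have e : m * (x ^+ 2 + y ^+ 2) <= x * s * x + y * t * y.
  have := ler_wpM2r (sqr_ge0 x) ms; have := ler_wpM2r (sqr_ge0 y) mt; rewrite !expr2; lra.
apply: (@le_trans _ _ (M ^+ 2 * ((x ^+ 2 + y ^+ 2) / 2))).
  by apply: ler_pM => //; exact: mulr_ge0.
rewrite (_ : _ / 2 = (m * (x ^+ 2 + y ^+ 2)) / (2 * m)); last by field; lra.
rewrite [leRHS]mulrAC -[leRHS]mulrA; apply: ler_wpM2l; first exact: sqr_ge0.
by rewrite ler_pM2r ?invr_gt0//; lra.
Qed.

Theorem theorem1 (R : realType) (a b tau : R) (l : R -> R)
  (q11m q22m q11p q22p : R -> R) (m M r : R) (WB : 'M[R]_(2, 4)) :
  a < 0 -> 0 < b -> 0 < tau ->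
  C1_on 0 tau l -> (forall t, 0 <= t <= tau -> a < l t < b) ->
  C1_on a b q11m -> C1_on a b q22m -> C1_on a b q11p -> C1_on a b q22p ->
  0 < m -> m <= M ->
  (forall z, a <= z <= b ->
     [/\ m <= q11m z <= M, m <= q22m z <= M, m <= q11p z <= M & m <= q22p z <= M]) ->
  q11p 0 / q11m 0 = 1 ->
  (forall z, a <= z <= b -> q11p z / q11m z = q22p z / q22m z) ->
  r = 0 ->
  \rank WB = 2%N ->
  psd2 (WB *m Sigma R *m WB^T) ->
  exists omega : R, 0 < omega /\
    forall t, 0 <= t <= tau ->
    forall x1 x2 g1 g2 : R -> R,
      domA a b q11m q22m q11p q22p r WB (l t) x1 x2 g1 g2 ->
      ipQ0 a b q11m q22m q11p q22p (fun z => - g2 z) (fun z => - g1 z) x1 x2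
        <= omega * ipQ0 a b q11m q22m q11p q22p x1 x2 x1 x2.
Proof.
move=> a0 b0 _ _ lab c1m c2m c1p c2p m0 mM qB k0 kE -> rW psd.
have q1m0 z : a <= z <= b -> q11m z != 0 by move=> /qB[? _ _ _]; lra.
have q2m0 z : a <= z <= b -> q22m z != 0 by move=> /qB[_ ? _ _]; lra.
have q1p0 z : a <= z <= b -> q11p z != 0 by move=> /qB[_ _ ? _]; lra.
have q2p0 z : a <= z <= b -> q22p z != 0 by move=> /qB[_ _ _ ?]; lra.
have ab0 : a <= 0 <= b by rewrite !ltW.
(* The reciprocal ratios serve the case [l < 0], where [Q_0] selects the minus coefficients and
   [Q_l] the plus ones between [l] and [0]. *)
have k0' : q11m 0 / q11p 0 = 1 by rewrite -[LHS]invrK invf_div k0 invr1.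
have kE' z : a <= z <= b -> q11m z / q11p z = q22m z / q22p z.
  by move=> zab; rewrite -[LHS]invrK invf_div kE// invf_div.
have [dk1 [ak1 ck1]] := C1_on_ac _ _ _ (C1_on_div a b q11p q11m q1m0 c1p c1m).
have [dk2 [ak2 ck2]] := C1_on_ac _ _ _ (C1_on_div a b q11m q11p q1p0 c1m c1p).
have [K1 K10 K1B] := continuous_bounded _ _ _ ck1.
have [K2 K20 K2B] := continuous_bounded _ _ _ ck2.
have C0 : 0 < M ^+ 2 / (2 * m).
  by rewrite divr_gt0 ?exprn_gt0 ?mulr_gt0// (lt_le_trans m0 mM).
(* [K1] and [K2] bound the derivatives of the two ratios on all of [Icc a b], so their sum serves
   both positions of the interface and is fixed before [t]. The other factor is the constant of
   [flux_le_energy]. *)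
exists ((K1 + K2) * (M ^+ 2 / (2 * m))); split; first by rewrite mulr_gt0// addr_gt0.
move=> t /lab; move: (l t) => {}l {lab} lab x1 x2 g1 g2 [[s1 s2] H2 [H1l H1r] fI W].
have /andP[al lb] := lab; rewrite mul0r in fI.
rewrite /ipQ0 mulrCA ler_pM2l ?invr_gt0//.
set w := (fun z => x1 z * qsel 0 q11m q11p z * x1 z + _).
set phi := (fun z => x1 z * qsel 0 q11m q11p z * - g2 z + _).
have aP := ac_on_flux a b l _ _ _ _ lab H1l H1r H2 fI.
have Pab := boundary_flux_ge0 R WB _ _ _ _ rW psd W.
set P := (fun z => _ * _) in aP; set p := (fun z => _ + _) in aP.
have Pl : P l = 0 by rewrite /P fI mulr0.
have Iw : int_on a b w by exact: int_on_energy.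
have qsB s z : a <= z <= b -> m <= qsel s q11m q11p z <= M /\ m <= qsel s q22m q22p z <= M.
  by move=> /qB[? ? ? ?]; rewrite /qsel; case: ifP.
have w0 z : a <= z <= b -> 0 <= w z.
  by move=> /(qsB 0)[/andP[? _] /andP[? _]]; rewrite /w; nra.
have PC z : a <= z <= b -> `|P z| <= M ^+ 2 / (2 * m) * w z.
  move=> zab; have [/andP[? _] /andP[? _]] := qsB 0 z zab; have [? ?] := qsB l z zab.
  exact: flux_le_energy.
(* Where [Q_l] and [Q_0] select the same side, the weight is [1]. *)
have phiE z : (z < l) = (z < 0) -> phi z = - p z.
  by move=> E; rewrite /phi /p /qsel E; ring.
have [l0|l0] := leP 0 l.
(* Between [0] and [l] the weight is plus over minus: [h] vanishes at the left end by [k0], and [P]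
   at the right end by [Pl]. *)
- apply: (flux_estimate a 0 l b _ _ P p (fun z => q11p z / q11m z - 1) dk1) => //; rewrite ?ltW//.
  + exact: ac_onB1 (ltW a0) (ltW lb) ak1.
  + by rewrite k0 subrr mul0r.
  + by rewrite Pl mulr0.
  + by move=> z /andP[_ z0]; apply: phiE; rewrite z0 (lt_le_trans z0 l0).
  + move=> z /andP[z0 zl]; have zab : a <= z <= b by rewrite !ltW ?(lt_trans a0)// (lt_trans zl).
    (* Equality of the two ratios allows each component of [p] to be weighted by its own ratio,
       turning [Q_l] entries into [Q_0] entries. *)
    have -> : p z + (q11p z / q11m z - 1) * p z =
        q11p z / q11m z * (q11m z * x1 z * g2 z) + q22p z / q22m z * (q22m z * x2 z * g1 z).
      by rewrite -kE// /p /qsel zl; ring.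
    rewrite /phi /qsel ltNge (ltW z0) /=; field.
    by rewrite q1m0 ?q2m0.
  + move=> z /andP[lz _]; apply: phiE.
    by rewrite !ltNge (ltW lz) (ltW (le_lt_trans l0 lz)).
  + move=> z /andP[z0 zl]; apply: (@le_trans _ _ K1); last by rewrite lerDl ltW.
    by apply: K1B; rewrite (le_trans (ltW a0) z0) (le_trans zl (ltW lb)).
  + by rewrite addr_gt0.
(* Mirror case: the weight is minus over plus, [P] vanishes at the left end and [h] at the right
   end. *)
- apply: (flux_estimate a l 0 b _ _ P p (fun z => q11m z / q11p z - 1) dk2) => //; rewrite ?ltW//.
  + exact: ac_onB1 (ltW al) (ltW b0) ak2.
  + by rewrite Pl mulr0.
  + by rewrite k0' subrr mul0r.
  + by move=> z /andP[_ zl]; apply: phiE; rewrite zl (lt_trans zl l0).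
  + move=> z /andP[lz z0]; have zab : a <= z <= b by rewrite !ltW ?(lt_trans al)// (lt_trans z0).
    have -> : p z + (q11m z / q11p z - 1) * p z =
        q11m z / q11p z * (q11p z * x1 z * g2 z) + q22m z / q22p z * (q22p z * x2 z * g1 z).
      by rewrite -kE'// /p /qsel ltNge (ltW lz) /=; ring.
    rewrite /phi /qsel z0; field.
    by rewrite q1p0 ?q2p0.
  + move=> z /andP[z0 _]; apply: phiE.
    by rewrite !ltNge (ltW z0) (ltW (lt_trans l0 z0)).
  + move=> z /andP[lz z0]; apply: (@le_trans _ _ K2); last by rewrite lerDr ltW.
    by apply: K2B; rewrite (le_trans (ltW al) lz) (le_trans z0 (ltW b0)).
  + by rewrite addr_gt0.
Qed.
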